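(* Let $n,b,d$ be nonnegative integers. Then \[\sum_{k=0}^n \binom{n}{k}^2\frac{\binom{k+bn}{k}\binom{n+dn}{k}}{\binom{n+bn}{k}\binom{k+dn}{k}}\Big\{1+(n-2k)\big(2H_k-H_{bn+k}+H_{dn+k}\big)\Big\} = (-1)^n\frac{\binom{bn-dn}{n}}{\binom{n+bn}{n}\binom{n+dn}{n}}.\]
   Context: $H_0=0$ and $H_m=\sum_{j=1}^m \frac{1}{j}$ for positive integers $m$. For an integer $m$ (possibly negative) and a nonnegative integer $j$, $\binom{m}{j}=\frac{m(m-1)\cdots(m-j+1)}{j!}$. *)

(* Defs.v *)
From mathcomp Require Import all_boot all_order all_algebra.

Set Implicit Arguments.
Unset Strict Implicit.
Unset Printing Implicit Defensive.

Import Order.TTheory GRing.Theory Num.Theory.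
Local Open Scope ring_scope.

Definition harmonic (m : nat) : rat := \sum_(1 <= j < m.+1) (j%:R)^-1.

(* The upper argument may be negative, where ssrnat's binomial does not apply. *)
Definition binz (m : int) (j : nat) : rat :=
  (\prod_(i < j) (m - i%:Z)%:~R) / (j`!)%:R.

Lemma binz_nat (m j : nat) : binz m%:Z j = 'C(m, j)%:R.
Proof.
rewrite /binz; apply: (canLR (mulfK _)).
  by rewrite pnatr_eq0 -lt0n fact_gt0.
rewrite -natrM bin_ffact.
elim: j => [|j IHj]; first by rewrite big_ord0 ffactn0.
rewrite big_ord_recr /= IHj ffactnSr natrM.
have [le_jm | lt_mj] := leqP j m; first by rewrite subzn.
by rewrite ffact_small // !mul0r.
Qed.

(* Main.v *)
(** The summand is symmetric under [k <-> n - k] up to the harmonic factor, and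
    the sum is [-1/2] times the sum over [k] of the [k]-derivative of
    [(n - 2k) u(k)], where [u(k)] is a quotient of factorials.  Replace [bn] and
    [dn] by independent [B] and [D].  As a function of [B] the (normalised) sum
    is a polynomial [P] of degree at most [n]; differentiating a creative
    telescoping relation for [(n - 2k) u(k)] gives
    [(D + n - B - 1) P(B + 1) = (D - B - 1) P(B)] for [B <> -1].  Reading this
    downwards from [B = D + n - 1], [P] vanishes at [D, ..., D + n - 1]; at
    [B = -1] only the term [k = n] survives.  These [n + 1] values determine [P]. *)

Require Import Defs.
From mathcomp Require Import all_boot all_order all_algebra.
From mathcomp Require Import ring lra zify.

Import Order.TTheory GRing.Theory Num.Theory.
Local Open Scope ring_scope.

(** * Reflection [k -> n - k] of sums, and the telescoping recurrence *)

Lemma sum_reflect (V : nmodType) (n : nat) (f : nat -> V) :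
  \sum_(0 <= k < n.+1) f k = \sum_(0 <= k < n.+1) f (n - k)%N.
Proof. by rewrite big_nat_rev; apply: eq_bigr => k _; rewrite add0n subSS. Qed.

(** Reflection fixes [c] and negates [f], so the sum equals its own negative. *)
Lemma sum_symmetrize {n : nat} {c : nat -> rat} (f : nat -> rat) :
    (forall k, (k <= n)%N -> c (n - k)%N = c k) ->
    (forall k, (k <= n)%N -> f k + f (n - k)%N = 0) ->
  \sum_(0 <= k < n.+1) c k * f k = 0.
Proof.
move=> c_sym f_odd.
suff: \sum_(0 <= k < n.+1) c k * f k = - \sum_(0 <= k < n.+1) c k * f k by lra.
rewrite {1}sum_reflect -sumrN; apply: eq_big_nat => k /andP[_]; rewrite ltnS => le_kn.
by rewrite c_sym // -mulrN; congr (_ * _); have := f_odd k le_kn; lra.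
Qed.

Lemma harmonicS (m : nat) : harmonic m.+1 = harmonic m + m.+1%:R^-1.
Proof. by rewrite /harmonic big_nat_recr. Qed.

Lemma natr_fact_neq0 (m : nat) : m`!%:R != 0 :> rat.
Proof. by rewrite pnatr_eq0 -lt0n fact_gt0. Qed.

(* With [alpha = D + n - a] and [beta = a^2 (D - a)], the certificate is
     (n - 2k) (alpha (a + k) (a + n - k) - beta)
     = (n - k)^2 (a + k) (D + n - k) - k^2 (D + k) (a + n - k).
   [- e k] stands for [c k] times the part of its logarithmic derivative in [k]
   that comes from the factors indexed by [k] rather than [n - k]. *)
Lemma telescoping_recurrence (n : nat) (a D : rat) (c e : nat -> rat) :
    (forall k, (k <= n)%N -> c (n - k)%N = c k) ->
    (forall k, (k < n)%N ->
       k.+1%:R ^+ 2 * (D + k.+1%:R) * (a + n%:R - k.+1%:R) * e k.+1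
       = (n%:R - k%:R) ^+ 2 * (D + n%:R - k%:R) * ((a + k%:R) * e k - c k)
         + k.+1%:R * (3 * k.+1%:R + 2 * D) * (a + n%:R - k.+1%:R) * c k.+1) ->
  (D + n%:R - a) * (\sum_(0 <= k < n.+1)
     ((a + k%:R) * (a + n%:R - k%:R) * (c k + (n%:R - 2 * k%:R) * e k)
      - (n%:R - 2 * k%:R) * (a + n%:R - k%:R) * c k))
  = a ^+ 2 * (D - a) * \sum_(0 <= k < n.+1) (c k + (n%:R - 2 * k%:R) * e k).
Proof.
move=> c_sym e_rec.
(* [e_rec] says that [T k.+1 = U k]; as [U n] and [T 0] vanish, the two sums agree. *)
pose T k := k%:R ^+ 2 * (D + k%:R) * (a + n%:R - k%:R) * e k
            - k%:R * (3 * k%:R + 2 * D) * (a + n%:R - k%:R) * c k.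
pose U k := (n%:R - k%:R) ^+ 2 * (D + n%:R - k%:R) * ((a + k%:R) * e k - c k).
have sumTU : \sum_(0 <= k < n.+1) U k = \sum_(0 <= k < n.+1) T k.
  rewrite big_nat_recr //= [RHS]big_nat_recl //.
  have -> : U n = 0 by rewrite /U subrr expr0n /= !mul0r.
  have -> : T 0 = 0 by rewrite /T; ring.
  rewrite addr0 add0r; apply: eq_big_nat => k /andP[_ lt_kn].
  by have := e_rec k lt_kn; rewrite /U /T => ->; ring.
(* The coefficient of [c k] that remains once the certificate has put all [e k] terms into
   [U k - T k]; it is odd under reflection. *)
pose f k := (n%:R - k%:R) ^+ 2 * (D + n%:R - k%:R)
   - k%:R * (3 * k%:R + 2 * D) * (a + n%:R - k%:R)
   + (D + n%:R - a) * ((a + k%:R) * (a + n%:R - k%:R)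
                       - (n%:R - 2 * k%:R) * (a + n%:R - k%:R))
   - a ^+ 2 * (D - a).
have sum_f : \sum_(0 <= k < n.+1) c k * f k = 0.
  by apply: sum_symmetrize => // k le_kn; rewrite /f natrB //; ring.
apply/eqP; rewrite -subr_eq0; apply/eqP.
transitivity (\sum_(0 <= k < n.+1) c k * f k
              + (\sum_(0 <= k < n.+1) U k - \sum_(0 <= k < n.+1) T k)).
  rewrite !big_distrr /= -!sumrB -big_split /=.
  by apply: eq_bigr => k _; rewrite /f /T /U; ring.
by rewrite sum_f sumTU subrr addr0.
Qed.

(* [(B + 1)_k] as a polynomial in [B]; its derivative in [B] encodes
   [harmonic (B + k) - harmonic B] (see [deriv_rising_nat]) without poles, so
   that the sum can be evaluated at [B = -1]. *)
Definition rising (k : nat) : {poly rat} := \prod_(i < k) ('X + i.+1%:R%:P).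

(** * Recursion, unit shift and special values of rising factorials *)

Lemma risingS (k : nat) : rising k.+1 = rising k * ('X + k.+1%:R%:P).
Proof. by rewrite /rising big_ord_recr. Qed.

Lemma horner_risingS (k : nat) (x : rat) :
  (rising k.+1).[x] = (rising k).[x] * (x + k.+1%:R).
Proof. by rewrite risingS !hornerE. Qed.

Lemma horner_deriv_risingS (k : nat) (x : rat) :
  (rising k.+1)^`().[x]
  = (rising k)^`().[x] * (x + k.+1%:R) + (rising k).[x].
Proof. by rewrite risingS derivM derivD derivX derivC addr0 !hornerE. Qed.

Lemma rising0 : rising 0 = 1.
Proof. by rewrite /rising big_ord0. Qed.

Lemma horner_rising0 (x : rat) : (rising 0).[x] = 1.
Proof. by rewrite rising0 hornerE. Qed.

Lemma horner_deriv_rising0 (x : rat) : (rising 0)^`().[x] = 0.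
Proof. by rewrite rising0 derivC hornerE. Qed.

Lemma size_rising (k : nat) : size (rising k) = k.+1.
Proof.
elim: k => [|k IHk]; first by rewrite rising0 size_poly1.
by rewrite risingS size_Mmonic ?monicXaddC ?size_XaddC -?size_poly_eq0 ?IHk // addn2.
Qed.

(** Both sides are the product of the [x + i] for [i] from 1 to [k + 1]. *)
Lemma rising_shift (k : nat) (x : rat) :
  (x + 1) * (rising k).[x + 1] = (x + 1 + k%:R) * (rising k).[x].
Proof.
elim: k => [|k IHk]; first by rewrite rising0 !hornerE; ring.
by rewrite !horner_risingS mulrA IHk; ring.
Qed.

(** This is [rising_shift] differentiated in [x]. *)
Lemma deriv_rising_shift (k : nat) (x : rat) :
  (x + 1) * (rising k)^`().[x + 1] + (rising k).[x + 1]
  = (x + 1 + k%:R) * (rising k)^`().[x] + (rising k).[x].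
Proof.
elim: k => [|k IHk]; first by rewrite rising0 derivC !hornerE.
rewrite !horner_deriv_risingS !horner_risingS.
have := rising_shift k x; move: IHk.
move: (rising k).[x] (rising k).[x + 1] (_^`().[x]) (_^`().[x + 1]) => r s r' s' E1 E2.
transitivity ((x + 1 + k.+1%:R) * ((x + 1) * s' + s) + (x + 1) * s); first by ring.
by rewrite E1 E2; ring.
Qed.

Lemma rising_nat (k B : nat) : (rising k).[B%:R] = (B + k)`!%:R / B`!%:R.
Proof.
have B0 := natr_fact_neq0 B.
elim: k => [|k IHk]; first by rewrite rising0 hornerE addn0 divff.
by rewrite horner_risingS IHk addnS factS natrM -addnS natrD; field.
Qed.

Lemma deriv_rising_nat (k B : nat) :
  (rising k)^`().[B%:R]
  = (rising k).[B%:R] * (harmonic (B + k) - harmonic B).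
Proof.
elim: k => [|k IHk]; first by rewrite rising0 derivC addn0 subrr !hornerE.
rewrite horner_deriv_risingS horner_risingS IHk addnS harmonicS -natrD addnS.
have : (B + k).+1%:R != 0 :> rat by rewrite pnatr_eq0.
by move: (_.+1%:R) => y y0; field.
Qed.

Lemma rising_root (k : nat) : (rising k.+1).[-1] = 0.
Proof.
elim: k => [|k IHk]; rewrite horner_risingS ?IHk ?mul0r //.
by rewrite addNr mulr0.
Qed.

(** At the simple root [-1] the derivative is the product of the other factors, 1 to [k]. *)
Lemma deriv_rising_root (k : nat) : (rising k.+1)^`().[-1] = k`!%:R.
Proof.
elim: k => [|k IHk]; rewrite horner_deriv_risingS.
  by rewrite rising0 derivC !hornerE.
by rewrite IHk rising_root factS natrM; ring.
Qed.

(** * The normalised sum as a polynomial in [B], its shift relation and its roots *)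

Section Summand.
Variables n D : nat.

(** The [k]-dependent factorials of the summand that are free of [B]; those with [B] enter through
    [rising]. *)
Definition weight (k : nat) : rat :=
  ((k`! * (n - k)`!)%:R ^+ 2 * ((D + k)`! * (D + (n - k))`!)%:R)^-1.

Definition hsum (k : nat) : rat := 2 * harmonic k + harmonic (D + k).

Definition csum (x : rat) (k : nat) : rat :=
  weight k * (rising k).[x] * (rising (n - k)).[x].

(** Up to a multiple of [csum] constant in [k], this is minus the derivative of [csum] along its
    [k]-indexed factors. The derivative of [rising k] in [x] replaces the one in [k], since
    [(x + k)!] depends on [x + k] alone. *)
Definition esum (x : rat) (k : nat) : rat :=
  weight k * ((rising k).[x] * hsum k - (rising k)^`().[x]) * (rising (n - k)).[x].

Definition psum : {poly rat} :=
  \sum_(0 <= k < n.+1) weight k *: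
    (((1 + (n%:R - 2 * k%:R) * hsum k) *: rising k
      - (n%:R - 2 * k%:R) *: (rising k)^`()) * rising (n - k)).

Lemma horner_psum (x : rat) :
  psum.[x] = \sum_(0 <= k < n.+1) (csum x k + (n%:R - 2 * k%:R) * esum x k).
Proof.
rewrite /psum horner_sum; apply: eq_bigr => k _.
by rewrite /csum /esum hornerZ hornerM hornerD hornerN !hornerZ; ring.
Qed.

Lemma size_psum : (size psum <= n.+1)%N.
Proof.
rewrite /psum big_nat; apply: (leq_trans (size_sum _ _ _)).
apply/bigmax_leqP_seq => k _ /andP[_]; rewrite ltnS => le_kn.
apply: (leq_trans (size_scale_leq _ _)); apply: (leq_trans (size_polyMleq _ _)).
rewrite size_rising addnS /= -[n in (_ <= n.+1)%N](subnKC le_kn) -addSn leq_add2r.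
apply: (leq_trans (size_polyD _ _)); rewrite size_polyN geq_max.
rewrite !(leq_trans (size_scale_leq _ _)) ?size_rising //.
by rewrite (leq_trans (ltnW (lt_size_deriv _))) -?size_poly_eq0 ?size_rising.
Qed.

Lemma weight_sym (k : nat) : (k <= n)%N -> weight (n - k) = weight k.
Proof.
by move=> le_kn; rewrite /weight subKn // mulnC [(_ * (D + k)`!)%N]mulnC.
Qed.

Lemma csum_sym (x : rat) (k : nat) : (k <= n)%N -> csum x (n - k) = csum x k.
Proof. by move=> le_kn; rewrite /csum weight_sym // subKn // mulrAC. Qed.

Lemma weightS (k : nat) : (k < n)%N ->
  k.+1%:R ^+ 2 * (D%:R + k.+1%:R) * weight k.+1
  = (n%:R - k%:R) ^+ 2 * (D%:R + n%:R - k%:R) * weight k.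
Proof.
move=> lt_kn; rewrite /weight.
have [m ->] : exists m, n = (k + m.+1)%N by exists (n - k.+1)%N; lia.
have sum_neq0 : forall D k m, (D%:R + k%:R + m%:R + 1 != 0 :> rat).
  by move=> ? ? ?; rewrite -!natrD -[1]/(1%:R) -natrD addn1 pnatr_eq0.
have -> : (k + m.+1 - k.+1 = m)%N by lia.
have -> : (k + m.+1 - k = m.+1)%N by lia.
rewrite !addnS !factS !natrM.
have := natr_fact_neq0 k; have := natr_fact_neq0 m.
have := natr_fact_neq0 (D + k); have := natr_fact_neq0 (D + m).
move: _`!%:R _`!%:R _`!%:R _`!%:R => f1 f2 f3 f4 n1 n2 n3 n4.
have := sum_neq0 D k 0; have := sum_neq0 D m 0.
have := sum_neq0 0 k 0; have := sum_neq0 0 m 0.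
rewrite !add0r !addr0 -!natr1 !natrD => m1 m2 m3 m4.
field.
by do ?[apply/andP; split].
Qed.

(** The first-order recurrence of [csum] in [k], differentiated with the factors in [n - k] held
    fixed; it supplies [e_rec] with [a = x + 1]. *)
Lemma csum_esum_step (x : rat) (k : nat) : (k < n)%N ->
  k.+1%:R ^+ 2 * (D%:R + k.+1%:R) * (x + 1 + n%:R - k.+1%:R) * esum x k.+1
  = (n%:R - k%:R) ^+ 2 * (D%:R + n%:R - k%:R)
      * ((x + 1 + k%:R) * esum x k - csum x k)
    + k.+1%:R * (3 * k.+1%:R + 2 * D%:R) * (x + 1 + n%:R - k.+1%:R)
      * csum x k.+1.
Proof.
move=> lt_kn; rewrite /esum /csum /hsum addnS !harmonicS.
rewrite horner_deriv_risingS horner_risingS.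
have -> : (n - k = (n - k.+1).+1)%N by lia.
rewrite horner_risingS.
have -> : (n - k.+1).+1%:R = n%:R - k%:R :> rat by rewrite subnSK // natrB // ltnW.
have -> : (D + k).+1%:R = D%:R + k.+1%:R :> rat by rewrite -addnS natrD.
have k0 : k.+1%:R != 0 :> rat by rewrite pnatr_eq0.
have Dk0 : D%:R + k.+1%:R != 0 :> rat by rewrite -natrD pnatr_eq0 addnS.
have W := weightS k lt_kn.
have -> : weight k.+1 = (n%:R - k%:R) ^+ 2 * (D%:R + n%:R - k%:R) * weight k
    / (k.+1%:R ^+ 2 * (D%:R + k.+1%:R)).
  by rewrite -W mulrC mulKf // mulf_neq0 ?expf_neq0.
have -> : k%:R = k.+1%:R - 1 :> rat by rewrite -natr1 addrK.
move: k.+1%:R k0 Dk0 => j j0 Dj0.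
by field; rewrite j0 Dj0.
Qed.

Lemma psum_shift (x : rat) : x + 1 != 0 ->
  (D%:R + n%:R - (x + 1)) * psum.[x + 1] = (D%:R - (x + 1)) * psum.[x].
Proof.
move=> x0; apply: (mulfI (expf_neq0 2 x0)).
rewrite mulrCA [RHS]mulrA.
have := telescoping_recurrence n (x + 1) D%:R (csum x) (esum x)
  (csum_sym x) (csum_esum_step x).
rewrite -horner_psum => <-; congr (_ * _).
rewrite horner_psum big_distrr /=.
(* The shift of [rising k] adds [1 / (x + 1)] to its logarithmic derivative for every [k]; this
   constant contributes an odd sum. *)
have odd_part : \sum_(0 <= k < n.+1) csum x k *
    ((n%:R - 2 * k%:R) * (x + 1 + k%:R) * (x + 1 + n%:R - k%:R) / (x + 1)) = 0.
  by apply: (sum_symmetrize _ (csum_sym x)) => k le_kn; rewrite natrB //; ring.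
apply/eqP; rewrite -subr_eq0 -sumrB -[X in _ == X]odd_part; apply/eqP.
apply: eq_big_nat => k /andP[_]; rewrite ltnS => le_kn.
have := rising_shift k x; have := rising_shift (n - k) x.
have := deriv_rising_shift k x; rewrite natrB // /csum /esum.
move: (_^`().[x]) (_^`().[x + 1]) => r' s'.
move: (rising k).[x] (rising k).[x + 1] => r s.
move: (rising (n - k)).[x] (rising (n - k)).[x + 1] => t u E1 E2 E3.
have -> : u = (x + 1 + (n%:R - k%:R)) * t / (x + 1) by rewrite -E2; field.
have Es : s = (x + 1 + k%:R) * r / (x + 1) by rewrite -E3; field.
have -> : s' = ((x + 1 + k%:R) * r' + r - s) / (x + 1) by rewrite -E1; field.
by rewrite Es; field.
Qed.

Lemma psum_root (i : nat) : (i < n)%N -> psum.[(D + i)%:R] = 0.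
Proof.
move=> lt_in.
have [m Em] : exists m, (n = i + m.+1)%N by exists (n - i.+1)%N; lia.
(* Downward induction on [i]: for [m = 0] the left factor in [psum_shift] is zero, otherwise the
   value at the next point is. The right factor is [-(i + 1)], never zero. *)
elim: m i lt_in Em => [|m IHm] i lt_in Em.
all: have xN0 : (D + i)%:R + 1 != 0 :> rat by rewrite natr1 pnatr_eq0.
all: have := psum_shift _ xN0.
  have -> : D%:R + n%:R - ((D + i)%:R + 1) = 0 :> rat.
    by rewrite natr1 -natrD Em addn1 addnS subrr.
  move=> /esym/eqP; rewrite mul0r mulf_eq0 => /orP[] /eqP // E.
  have : D%:R = (D + i).+1%:R :> rat by rewrite -natr1; lra.
  by move/eqP; rewrite eqr_nat; lia.
rewrite natr1 -addnS (IHm i.+1) ?mulr0; try lia.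
move=> /esym/eqP; rewrite mulf_eq0 => /orP[] /eqP // E.
have : D%:R = (D + i.+1)%:R :> rat by lra.
by move/eqP; rewrite eqr_nat; lia.
Qed.

End Summand.

(** * Product formula for the polynomial by interpolation *)

Lemma psum_N1 (n D : nat) :
  (psum n.+1 D).[-1] = (n.+1`!%:R * (D + n.+1)`!%:R * D`!%:R)^-1.
Proof.
(* Each term but the last has a factor [rising] of positive index in [n.+1 - k], zero at [-1]; the
   last survives through the derivative of [rising n.+1]. *)
rewrite horner_psum big_nat_recl // big_nat_recr //= big1_seq => [|k /andP[_]].
  rewrite /csum /esum /weight !subn0 subnn horner_rising0 horner_deriv_rising0.
  rewrite rising_root deriv_rising_root addn0 fact0 factS !natrM.
  have := natr_fact_neq0 n; have := natr_fact_neq0 D.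
  have := natr_fact_neq0 (D + n.+1).
  have : n.+1%:R != 0 :> rat by rewrite pnatr_eq0.
  move: n.+1%:R _`!%:R _`!%:R _`!%:R => y f g h y0 f0 g0 h0.
  by field; rewrite y0 f0 g0 h0.
rewrite mem_iota => /andP[_ lt_kn]; rewrite /csum /esum.
have -> : (n.+1 - k.+1 = (n - k.+1).+1)%N by lia.
by rewrite !rising_root !mulr0 addr0.
Qed.

Lemma prodr_fact (D n : nat) :
  \prod_(i < n) (D%:R + 1 + i%:R) = (D + n)`!%:R / D`!%:R :> rat.
Proof.
have D0 := natr_fact_neq0 D.
elim: n => [|n IHn]; first by rewrite big_ord0 addn0 divff.
by rewrite big_ord_recr /= IHn addnS factS natrM -natr1 natrD; field.
Qed.

Lemma horner_psum_prod (n D : nat) (x : rat) :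
  (psum n D).[x]
  = (\prod_(i < n) (D%:R - x + i%:R)) / (n`!%:R * (D + n)`!%:R ^+ 2).
Proof.
case: n => [|n].
  rewrite horner_psum big_nat1 big_ord0 /csum /esum /weight horner_rising0.
  by rewrite subnn addn0 fact0 !natrM; field; rewrite natr_fact_neq0.
(* The roots are [D] to [D + n]; the constant is fixed by the value at [-1]. *)
pose q : {poly rat} := (n.+1`!%:R * (D + n.+1)`!%:R ^+ 2)^-1 *:
  \prod_(i < n.+1) (D%:R%:P - 'X + i%:R%:P).
have qE y : q.[y]
    = (\prod_(i < n.+1) (D%:R - y + i%:R)) / (n.+1`!%:R * (D + n.+1)`!%:R ^+ 2).
  rewrite hornerZ horner_prod mulrC; congr (_ * _).
  by apply: eq_bigr => i _; rewrite !hornerE.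
have size_q : (size q <= n.+2)%N.
  rewrite (leq_trans (size_scale_leq _ _)) //.
  rewrite (leq_trans (size_prod_leq _ _)) //.
  rewrite (eq_bigr (fun=> 2%N)) => [|i _].
    by rewrite sum_nat_const card_ord; lia.
  rewrite -addrA [- 'X + _]addrC addrA -polyCD -opprB size_polyN.
  by rewrite size_XsubC.
rewrite -qE; congr _.[x]; apply/eqP; rewrite -subr_eq0; apply/eqP.
(* These [n + 2] distinct points outnumber the degree of the difference, which is at most
   [n + 1]. *)
pose rs : seq rat := -1 :: [seq (D + i)%:R | i <- iota 0 n.+1].
apply: (@roots_geq_poly_eq0 _ _ rs).
- apply/allP => y; rewrite inE => /predU1P[->|].
    rewrite /root hornerD hornerN psum_N1 qE opprK prodr_fact subr_eq0.
    apply/eqP.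
    have := natr_fact_neq0 n.+1; have := natr_fact_neq0 D.
    have := natr_fact_neq0 (D + n.+1).
    move: _`!%:R _`!%:R _`!%:R => f g h f0 g0 h0.
    by field; rewrite f0 g0 h0.
  move=> /mapP[i]; rewrite mem_iota => /andP[_ lt_in] ->.
  rewrite /root hornerD hornerN psum_root // qE (bigD1 (Ordinal lt_in)) //=.
  have -> : D%:R - (D + i)%:R + i%:R = 0 :> rat by rewrite natrD; ring.
  by rewrite !mul0r subr0.
- rewrite cons_uniq map_inj_uniq ?iota_uniq ?andbT.
    apply/negP => /mapP[i _ E]; have : (0 : rat) <= (D + i)%:R by apply: ler0n.
    by rewrite -E.
  by move=> i j /eqP; rewrite eqr_nat eqn_add2l => /eqP.
- rewrite [size rs]/= size_map size_iota (leq_trans (size_polyD _ _)) //.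
  by rewrite size_polyN geq_max size_psum size_q.
Qed.

(** * Return to binomial coefficients and harmonic numbers *)

Lemma bin_fact_ratio (m k : nat) : (k <= m)%N ->
  'C(m, k)%:R = m`!%:R / (k`!%:R * (m - k)`!%:R) :> rat.
Proof.
move=> le_km; rewrite -(bin_fact le_km) !natrM mulfK //.
by rewrite mulf_neq0 ?natr_fact_neq0.
Qed.

(** The sign is absorbed by negating each of the [n] factors [B - D - i]. *)
Lemma binz_sub (B D n : nat) :
  (-1) ^+ n * binz (B%:Z - D%:Z) n
  = (\prod_(i < n) (D%:R - B%:R + i%:R)) / n`!%:R.
Proof.
rewrite /binz mulrA; congr (_ / _).
rewrite -[in (-1) ^+ n](card_ord n) -prodrN; apply: eq_bigr => i _.
by rewrite !rmorphB /=; ring.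
Qed.

Lemma harmonic_sum_closed (n B D : nat) :
  \sum_(0 <= k < n.+1)
     ('C(n, k)%:R ^+ 2
      * (('C(k + B, k)%:R * 'C(n + D, k)%:R)
         / ('C(n + B, k)%:R * 'C(k + D, k)%:R))
      * (1 + (n%:R - 2 * k%:R)
             * (2 * harmonic k - harmonic (B + k) + harmonic (D + k))))
  = (-1) ^+ n
    * (binz (B%:Z - D%:Z) n
       / ('C(n + B, n)%:R * 'C(n + D, n)%:R)) :> rat.
Proof.
(* The factorials of the summand that do not depend on [k]. *)
pose K : rat := n`!%:R ^+ 2 * (D + n)`!%:R * D`!%:R * B`!%:R / (B + n)`!%:R.
transitivity (K * (psum n D).[B%:R]); last first.
  rewrite horner_psum_prod [RHS]mulrA binz_sub !bin_fact_ratio ?leq_addr //.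
  rewrite !addKn ![(n + _)%N]addnC /K.
  have := natr_fact_neq0 n; have := natr_fact_neq0 D; have := natr_fact_neq0 B.
  have := natr_fact_neq0 (D + n); have := natr_fact_neq0 (B + n).
  move: (\prod_(i < n) _) => P.
  move: _`!%:R _`!%:R _`!%:R _`!%:R _`!%:R => f1 f2 f3 f4 f5 n1 n2 n3 n4 n5.
  by field; do ?[apply/andP; split].
(* [deriv_rising_nat] gives [harmonic (B + k) - harmonic B]; the constant [harmonic B] drops out by
   oddness. *)
have odd_part : \sum_(0 <= k < n.+1)
    csum n D B%:R k * ((n%:R - 2 * k%:R) * harmonic B) = 0.
  by apply: (sum_symmetrize _ (csum_sym n D B%:R)) => k le_kn; rewrite natrB //; ring.
rewrite -[(psum n D).[_]]subr0 -[X in _ - X]odd_part horner_psum -sumrB big_distrr /=.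
apply: eq_big_nat => k /andP[_]; rewrite ltnS => le_kn.
rewrite /csum /esum /hsum deriv_rising_nat !rising_nat /weight /K.
rewrite !bin_fact_ratio ?leq_addr ?(leq_trans le_kn) ?leq_addr //.
rewrite !addKn ![(n + _)%N]addnC -!addnBA // !natrM.
have := natr_fact_neq0 n; have := natr_fact_neq0 D; have := natr_fact_neq0 B.
have := natr_fact_neq0 (D + n); have := natr_fact_neq0 (B + n).
have := natr_fact_neq0 (D + k); have := natr_fact_neq0 (B + k).
have := natr_fact_neq0 (D + (n - k)); have := natr_fact_neq0 (B + (n - k)).
have := natr_fact_neq0 k; have := natr_fact_neq0 (n - k).
rewrite ![(k + _)%N]addnC.
move: (n - k)`!%:R k`!%:R (B + (n - k))`!%:R (D + (n - k))`!%:R (B + k)`!%:R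
  (D + k)`!%:R (B + n)`!%:R (D + n)`!%:R B`!%:R D`!%:R n`!%:R.
move=> f1 f2 f3 f4 f5 f6 f7 f8 f9 f10 f11 n1 n2 n3 n4 n5 n6 n7 n8 n9 n10 n11.
by field; do ?[apply/andP; split].
Qed.

Theorem theorem6 (n b d : nat) :
  \sum_(0 <= k < n.+1)
     ('C(n, k)%:R ^+ 2
      * (('C(k + b * n, k)%:R * 'C(n + d * n, k)%:R)
         / ('C(n + b * n, k)%:R * 'C(k + d * n, k)%:R))
      * (1 + (n%:R - 2 * k%:R)
             * (2 * harmonic k - harmonic (b * n + k) + harmonic (d * n + k))))
  = (-1) ^+ n
    * (binz ((b * n)%:Z - (d * n)%:Z) n
       / ('C(n + b * n, n)%:R * 'C(n + d * n, n)%:R)) :> rat.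
Proof. exact: harmonic_sum_closed. Qed.
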